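(* Let $p$ be an odd prime. The solutions in non-negative integers $x,y,z$ of the Diophantine equation $$64^{x}+p^{y}=z^{2}$$ are given by $(x,y,z)=(k,1,2^{3k}+1)$ for $p=1+2^{3k+1}$, where $k$ is a non-negative integer. *)

(* Defs.v *)
From mathcomp Require Export all_boot.

(* Main.v *)
Require Import Defs.
From mathcomp Require Import all_boot.
From mathcomp Require Import zify.

(** Factoring [p ^ y = (z - 8 ^ x) (z + 8 ^ x)], both factors are powers of [p];
    as [p] does not divide their difference [2 * 8 ^ x], the smaller one is [1],
    so [p ^ y = 2 * 8 ^ x + 1].  This is [3] modulo [7], not a square, so [y] is
    odd.  Then [1 + p + ... + p ^ (y - 1)] is an odd divisor of
    [p ^ y - 1 = 2 ^ (3 x + 1)], hence equals [1] and [y = 1]. *)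

Lemma odd_geometric_sum (p n : nat) :
  odd p -> odd (\sum_(i < n) p ^ i) = odd n.
Proof.
move=> p_odd; elim: n => [|n IHn]; first by rewrite big_ord0.
by rewrite big_ord_recr /= oddD IHn oddX p_odd orbT addbT.
Qed.

Lemma odd_dvdn_exp2 (d n : nat) : odd d -> d %| 2 ^ n -> d = 1.
Proof.
move=> d_odd /(dvdn_pfactor _ _ (isT : prime 2)) [[//|m] _ def_d].
by rewrite def_d oddX in d_odd.
Qed.

Lemma odd_expn_eq_exp2_succ (p y n : nat) :
  odd p -> odd y -> p ^ y = (2 ^ n).+1 -> y = 1.
Proof.
move=> p_odd y_odd py.
have p_gt1 : 1 < p.
  (* For [p = 1] the equation would force [2 ^ n = 0]. *)
  case: p p_odd py => [|[|p]] // _; rewrite exp1n => -[] /esym/eqP.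
  by rewrite expn_eq0.
have := predn_exp p y; rewrite py /= => sum_eq.
have sum1 : \sum_(i < y) p ^ i = 1.
  apply: (odd_dvdn_exp2 _ n); first by rewrite odd_geometric_sum.
  by rewrite sum_eq dvdn_mull.
(* With the sum equal to 1, [p ^ y = (p - 1) + 1 = p ^ 1], and exponents are compared. *)
apply: (expnI p_gt1); rewrite expn1 py sum_eq sum1 muln1 prednK //.
exact: ltnW.
Qed.

(** The squares modulo 7 are 0, 1, 2, 4. The modulus 7 suits because 8 is 1 modulo 7, so
    [2 * 8 ^ x + 1] has the same residue for all [x]. *)
Lemma sqr_mod7_neq3 (w : nat) : w ^ 2 %% 7 != 3.
Proof.
rewrite -modnXm.
by case: (w %% 7) (ltn_pmod w (isT : 0 < 7)) => [|[|[|[|[|[|[|]]]]]]].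
Qed.

Lemma sqr_diff_prime_power (p a y z : nat) :
    prime p -> ~~ (p %| 2 * a) -> a ^ 2 + p ^ y = z ^ 2 ->
  z = a + 1.
Proof.
move=> p_prime p_ndvd sq_eq.
have py_gt0 : 0 < p ^ y by rewrite expn_gt0 prime_gt0.
have lt_az : a < z by rewrite -ltn_sqr -sq_eq; lia.
have fact : p ^ y = (z - a) * (z + a) by rewrite -subn_sqr -sq_eq addKn.
have : z - a %| p ^ y by rewrite fact dvdn_mulr.
have : z + a %| p ^ y by rewrite fact dvdn_mull.
move=> /(dvdn_pfactor _ _ p_prime) [j _ def_j].
move=> /(dvdn_pfactor _ _ p_prime) [[|i] _ def_i].
  (* Exponent 0 means [z - a = 1], the desired conclusion; a positive exponent must be refuted. *)
  by rewrite expn0 in def_i; lia.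
(* Positivity of [a] gives [z + a > 1], which excludes [j = 0] below. *)
have a_gt0 : 0 < a.
  by case: a p_ndvd {sq_eq lt_az fact def_i def_j}; rewrite ?muln0 ?dvdn0.
case/negP: p_ndvd.
have -> : 2 * a = (z + a) - (z - a) by lia.
rewrite dvdn_sub // ?def_i ?def_j; last by rewrite expnS dvdn_mulr.
case: j def_j => [|j] def_j; last by rewrite expnS dvdn_mulr.
by rewrite expn0 in def_j; lia.
Qed.

Theorem theorem3 (p : nat) (p_prime : prime p) (p_odd : odd p) (x y z : nat) :
  64 ^ x + p ^ y = z ^ 2 <->
  exists k : nat,
    p = 1 + 2 ^ (3 * k + 1) /\ (x, y, z) = (k, 1, 2 ^ (3 * k) + 1).
Proof.
have E64 k : 64 ^ k = (2 ^ (3 * k)) ^ 2 by rewrite (expnM 2 3) -expnM mulnC expnM.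
split; last first.
  move=> [k [-> [-> -> ->]]].
  by rewrite E64 expn1 expnD expn1 sqrnD exp1n muln1; lia.
rewrite E64 => eq_z; exists x.
have p_ndvd : ~~ (p %| 2 * 2 ^ (3 * x)).
  (* The product is itself a power of 2, so an odd divisor of it is 1. *)
  apply/negP; rewrite -expnS => /(odd_dvdn_exp2 _ _ p_odd) p1.
  by rewrite p1 in p_prime.
have def_z := sqr_diff_prime_power _ _ _ _ p_prime p_ndvd eq_z.
(* For [a = 2 ^ (3 * x)], this is [(a + 1) ^ 2 - a ^ 2 = 2 * a + 1]. *)
have py : p ^ y = (2 ^ (3 * x).+1).+1.
  by move: eq_z; rewrite def_z sqrnD [2 ^ _.+1]expnS exp1n muln1; lia.
have y_odd : odd y.
  apply/negPn/negP => y_even; have := sqr_mod7_neq3 (p ^ y./2).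
  rewrite -expnM muln2 even_halfK // py expnS expnM -addn1.
  by rewrite -modnDml -modnMmr -modnXm exp1n.
have y1 := odd_expn_eq_exp2_succ _ _ _ p_odd y_odd py.
by split; [rewrite addn1 add1n -py y1 expn1 | rewrite y1 def_z].
Qed.
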